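(* Let $\alpha_i\ge 0$, $\beta_i>0$ ($i\in\{1,2,4,5\}$) and $Q>0$ be real numbers. In the network $N$ with these parameters and total flow $Q$, the travel time at equilibrium is as follows: (a) $T_{Eq}=\alpha_{45}+Q\beta_{45}$ if $0<Q\le -\alpha/\beta_{45}$; (b) $T_{Eq}=\alpha_{12}+Q\beta_{12}$ if $0<Q\le \alpha/\beta_{12}$; (c) $T_{Eq}=\alpha_{12}+(\alpha+Q\beta_{45})\beta_{12}/\beta$ if $Q>\max\{\alpha/\beta_{12},\,-\alpha/\beta_{45}\}$.
   Context: The network $N$ has nodes $a,b,c,d$ and directed links $(a,b),(b,d),(a,c),(c,d)$ with travel times $\alpha_1+\beta_1f_{ab}$, $\alpha_2+\beta_2f_{bd}$, $\alpha_4+\beta_4f_{ac}$, $\alpha_5+\beta_5f_{cd}$ respectively, where $f_{ij}\ge 0$ is the (real) flow on link $(i,j)$ and $\alpha_i\ge 0$, $\beta_i>0$. All traffic, of total amount $Q>0$ (real), goes from $a$ to $d$ along the paths $P_1=a-b-d$ and $P_2=a-c-d$. A flow assigns a non-negative real amount to each path, with total $Q$; the flow on a link is the flow of the path containing it; the travel time on a path is the sum of the travel times of its links. A path has vanishing flow if its path flow is $0$. The network is at equilibrium if all paths with non-vanishing flow have the same travel time, and every path with vanishing flow has travel time at least this common value. The equilibrium exists and is unique; its common travel time is denoted $T_{Eq}$. Notation: $\alpha_{ij}=\alpha_i+\alpha_j$, $\beta_{ij}=\beta_i+\beta_j$, $\alpha=\alpha_{45}-\alpha_{12}$, $\beta=\beta_1+\beta_2+\beta_4+\beta_5$.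 *)

(* Defs.v *)
From HB Require Import structures.
From mathcomp Require Import all_boot all_order all_algebra.
From mathcomp Require Import reals.

Set Implicit Arguments.
Unset Strict Implicit.
Unset Printing Implicit Defensive.

Import Order.TTheory GRing.Theory Num.Theory.
Local Open Scope ring_scope.

(* The real numbers are an arbitrary [realType] of MathComp. *)

Variant node := Na | Nb | Nc | Nd.
(* The numbers are the subscripts of the travel-time parameters; 3 is skipped. *)
Variant link := L1 | L2 | L4 | L5.
Variant npath := P1 | P2.

Definition node_code (x : node) : bool * bool :=
  match x with
  | Na => (false, false) | Nb => (false, true)
  | Nc => (true, false) | Nd => (true, true)
  end.
Definition node_decode (c : bool * bool) : node :=
  match c with
  | (false, false) => Na | (false, true) => Nb
  | (true, false) => Nc | (true, true) => Nd
  end.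
Lemma node_codeK : cancel node_code node_decode. Proof. by case. Qed.
HB.instance Definition _ := Finite.copy node (can_type node_codeK).

Definition link_code (l : link) : bool * bool :=
  match l with
  | L1 => (false, false) | L2 => (false, true)
  | L4 => (true, false) | L5 => (true, true)
  end.
Definition link_decode (c : bool * bool) : link :=
  match c with
  | (false, false) => L1 | (false, true) => L2
  | (true, false) => L4 | (true, true) => L5
  end.
Lemma link_codeK : cancel link_code link_decode. Proof. by case. Qed.
HB.instance Definition _ := Finite.copy link (can_type link_codeK).

Definition path_code (p : npath) : bool := if p is P1 then false else true.
Definition path_decode (c : bool) : npath := if c then P2 else P1.
Lemma path_codeK : cancel path_code path_decode. Proof. by case. Qed.
HB.instance Definition _ := Finite.copy npath (can_type path_codeK).

Definition link_ends (l : link) : node * node :=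
  match l with
  | L1 => (Na, Nb) | L2 => (Nb, Nd) | L4 => (Na, Nc) | L5 => (Nc, Nd)
  end.

Definition path_nodes (p : npath) : seq node :=
  match p with P1 => [:: Na; Nb; Nd] | P2 => [:: Na; Nc; Nd] end.

Definition on_path (l : link) (p : npath) : bool :=
  link_ends l \in zip (path_nodes p) (behead (path_nodes p)).

Section Traffic.
Variables (R : realType) (alpha beta : link -> R) (Q : R).
Implicit Types (f : {ffun npath -> R}) (l : link) (p : npath) (T : R).

Definition is_flow f : Prop := (forall p, 0 <= f p) /\ \sum_p f p = Q.

(* Each link lies on exactly one path, so the sum has a single term. *)
Definition link_flow f l : R := \sum_(p | on_path l p) f p.

Definition link_time f l : R := alpha l + beta l * link_flow f l.

Definition path_time f p : R := \sum_(l | on_path l p) link_time f l.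

Definition equilibrium_at f T : Prop :=
  [/\ is_flow f,
      forall p, f p != 0 -> path_time f p = T
    & forall p, f p = 0 -> T <= path_time f p].

Definition equilibrium f : Prop := exists T, equilibrium_at f T.

(* [is_T_Eq T] reads "T_Eq = T": the equilibrium exists, is unique, and T is
   its common travel time. For Q > 0 some path has non-vanishing flow, so at
   most one T qualifies. *)
Definition is_T_Eq T : Prop :=
  exists2 f, unique equilibrium f & equilibrium_at f T.

End Traffic.

(* Main.v *)
(** Flow moved from one path to the other makes the first strictly faster and
    the second strictly slower, so two distinct equilibria would contradict each
    other; hence the equilibrium is unique. It remains to check that sending 0,
    Q, or the flow equalising both travel times along P1 is an equilibrium. *)

Require Import Defs.
From HB Require Import structures.
From mathcomp Require Import all_boot all_order all_algebra.
From mathcomp Require Import reals.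
From mathcomp Require Import ring lra.

Set Implicit Arguments.
Unset Strict Implicit.
Unset Printing Implicit Defensive.

Import Order.TTheory GRing.Theory Num.Theory.
Local Open Scope ring_scope.

Lemma sum_npath (V : nmodType) (F : npath -> V) : \sum_p F p = F P1 + F P2.
Proof. by rewrite (bigD1 P1) //= (bigD1 P2) //= big1 ?addr0 // => -[]. Qed.

Section Traffic.
Variables (R : realType) (alpha beta : link -> R) (Q : R).
Implicit Types (f g : {ffun npath -> R}) (T x : R).

Lemma link_flow_P1 f l : l \in [:: L1; L2] -> link_flow f l = f P1.
Proof.
by case: l => // _; rewrite /link_flow (bigD1 P1) //= big1 ?addr0 // => -[].
Qed.

Lemma link_flow_P2 f l : l \in [:: L4; L5] -> link_flow f l = f P2.
Proof.
by case: l => // _; rewrite /link_flow (bigD1 P2) //= big1 ?addr0 // => -[].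
Qed.

Lemma path_time_P1 f :
  path_time alpha beta f P1 =
  alpha L1 + alpha L2 + (beta L1 + beta L2) * f P1.
Proof.
rewrite /path_time (bigD1 L1) //= (bigD1 L2) //= big1; last by case.
by rewrite /link_time !link_flow_P1 //; ring.
Qed.

Lemma path_time_P2 f :
  path_time alpha beta f P2 =
  alpha L4 + alpha L5 + (beta L4 + beta L5) * f P2.
Proof.
rewrite /path_time (bigD1 L4) //= (bigD1 L5) //= big1; last by case.
by rewrite /link_time !link_flow_P2 //; ring.
Qed.

Hypothesis beta_gt0 : forall l, 0 < beta l.

(** The common time [T] is attained on [p] and bounds the time of [q] from below, whether or not [q]
    carries flow. This eliminates [T], so equilibria with different times can be compared. *)
Lemma equilibrium_used_le f p q : equilibrium alpha beta Q f -> f p != 0 ->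
  path_time alpha beta f p <= path_time alpha beta f q.
Proof.
move=> [T [_ used unused]] /used ->.
by have [/unused|/used ->] := eqVneq (f q) 0.
Qed.

(** If [f P1 < g P1], the times close into an impossible cycle: [P1] under [g] <= [P2] under [g] <
    [P2] under [f] <= [P1] under [f] < [P1] under [g]. *)
Lemma equilibrium_le f g : equilibrium alpha beta Q f ->
  equilibrium alpha beta Q g -> g P1 <= f P1.
Proof.
move=> eqf eqg; rewrite leNgt; apply/negP => lt_fg.
have [_ [[f_ge0 +] _ _]] := eqf; rewrite sum_npath => fQ.
have [_ [[g_ge0 +] _ _]] := eqg; rewrite sum_npath => gQ.
have := f_ge0 P1; have := g_ge0 P2 => g2 f1.
(* Here [g P1 > f P1 >= 0], and equal totals give [f P2 > g P2 >= 0]. *)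
have /(equilibrium_used_le P2 eqg) : g P1 != 0 by rewrite gt_eqF; lra.
have /(equilibrium_used_le P1 eqf) : f P2 != 0 by rewrite gt_eqF; lra.
rewrite !path_time_P1 !path_time_P2.
have lt_gf : g P2 < f P2 by lra.
have b12 : 0 < beta L1 + beta L2 by rewrite addr_gt0.
have b45 : 0 < beta L4 + beta L5 by rewrite addr_gt0.
have : (beta L1 + beta L2) * f P1 < (beta L1 + beta L2) * g P1.
  by rewrite ltr_pM2l.
have : (beta L4 + beta L5) * g P2 < (beta L4 + beta L5) * f P2.
  by rewrite ltr_pM2l.
lra.
Qed.

Lemma equilibrium_unique f g : equilibrium alpha beta Q f ->
  equilibrium alpha beta Q g -> f = g.
Proof.
move=> eqf eqg.
have fg1 : f P1 = g P1 by apply/le_anti; rewrite !equilibrium_le.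
have [_ [[_ fQ] _ _]] := eqf; have [_ [[_ gQ] _ _]] := eqg.
move: fQ gQ; rewrite !sum_npath => fQ gQ.
apply/ffunP => -[] //; lra.
Qed.

(** Here [x] is the flow sent along [P1], and [t1], [t2] are the resulting path times; the flow on
    [P2] vanishes exactly when [x = Q]. *)
Lemma is_T_EqI x T (t1 := alpha L1 + alpha L2 + (beta L1 + beta L2) * x)
    (t2 := alpha L4 + alpha L5 + (beta L4 + beta L5) * (Q - x)) :
  0 <= x <= Q -> T <= t1 -> T <= t2 ->
  (x != 0 -> t1 = T) -> (x != Q -> t2 = T) ->
  is_T_Eq alpha beta Q T.
Proof.
move=> /andP[x_ge0 x_le] T1 T2 used1 used2.
pose f := [ffun p => if p is P1 then x else Q - x].
have eqf : equilibrium_at alpha beta Q f T.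
  split.
  - split=> [[]|]; rewrite ?sum_npath !ffunE ?subr_ge0 //.
    by rewrite addrC subrK.
  - case; rewrite ?path_time_P1 ?path_time_P2 !ffunE //.
    by rewrite subr_eq0 eq_sym; apply: used2.
  - by case; rewrite ?path_time_P1 ?path_time_P2 !ffunE.
exists f => //; split; first by exists T.
by move=> g; apply: equilibrium_unique; exists T.
Qed.

End Traffic.

Theorem lemma1 (R : realType) (alpha beta : link -> R) (Q : R)
    (alpha_ge0 : forall i : link, 0 <= alpha i)
    (beta_gt0 : forall i : link, 0 < beta i)
    (Q_gt0 : 0 < Q) :
  let alpha12 := alpha L1 + alpha L2 in
  let alpha45 := alpha L4 + alpha L5 in
  let beta12 := beta L1 + beta L2 in
  let beta45 := beta L4 + beta L5 in
  let a := alpha45 - alpha12 in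
  let b := beta L1 + beta L2 + beta L4 + beta L5 in
  [/\ Q <= - a / beta45 ->
        is_T_Eq alpha beta Q (alpha45 + Q * beta45),
      Q <= a / beta12 ->
        is_T_Eq alpha beta Q (alpha12 + Q * beta12)
    & Num.max (a / beta12) (- a / beta45) < Q ->
        is_T_Eq alpha beta Q (alpha12 + (a + Q * beta45) * beta12 / b)].
Proof.
move=> alpha12 alpha45 beta12 beta45 a b.
have b12 : 0 < beta12 by rewrite addr_gt0.
have b45 : 0 < beta45 by rewrite addr_gt0.
have b_gt0 : 0 < b by rewrite !addr_gt0.
split.
(* All traffic takes [P2]: the bound on [Q] says that even then the empty [P1] is no faster. *)
- rewrite ler_pdivlMr // => Qle; apply: (@is_T_EqI _ _ _ _ _ 0) => //.
  + by rewrite lexx ltW.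
  + by rewrite -/alpha12 mulr0 addr0; move: Qle; rewrite /a; lra.
  + by rewrite subr0 mulrC.
  + by rewrite eqxx.
  + by rewrite subr0 mulrC.
(* The mirror case, with [P2] empty. *)
- rewrite ler_pdivlMr // => Qle; apply: (@is_T_EqI _ _ _ _ _ Q) => //.
  + by rewrite lexx ltW.
  + by rewrite mulrC.
  + by rewrite -/alpha45 subrr mulr0 addr0; move: Qle; rewrite /a; lra.
  + by rewrite mulrC.
  + by rewrite eqxx.
- rewrite gt_max ltr_pdivrMr // ltr_pdivrMr // => /andP[Q12 Q45].
  have b_neq0 : b != 0 by rewrite gt_eqF.
  (* The solution of [alpha12 + beta12 * x = alpha45 + beta45 * (Q - x)], which equalises the two
     times. *)
  set x := (a + Q * beta45) / b.
  have T1 : alpha12 + beta12 * x = alpha12 + (a + Q * beta45) * beta12 / b.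
    by rewrite /x; field.
  have T2 : alpha45 + beta45 * (Q - x)
            = alpha12 + (a + Q * beta45) * beta12 / b.
    have xb : x * b = a + Q * beta45 by rewrite divfK.
    have bE : b = beta12 + beta45 by rewrite /b addrA.
    rewrite -T1; move: xb; rewrite bE /a; lra.
  apply: (is_T_EqI beta_gt0 (x := x)); rewrite ?T1 ?T2 //.
  (* With denominators cleared, [x <= Q] becomes [a <= Q * beta12] and [0 <= x] becomes
     [- a <= Q * beta45]: the two bounds packed in the maximum. *)
  rewrite ler_pdivrMr // divr_ge0 ?(ltW b_gt0) //=.
    have -> : b = beta12 + beta45 by rewrite /b addrA.
    by rewrite (mulrDr Q beta12) lerD2r ltW.
  by rewrite -lerBlDl sub0r ltW.
Qed.
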